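(* Let $\rho\colon \mathrm{SL}_2(\mathbf{C})\to \mathrm{GL}(V)$ be an irreducible finite-dimensional algebraic representation. Then $V$ exhibits optimal $\mathrm{SL}_2(\mathbf{C})$-additive diameters, i.e. for every nonzero linear subspace $U\leq V$, \[ \mathrm{diam}_+^{\mathrm{SL}_2(\mathbf{C})}(V,U)=\left\lceil \frac{\dim V}{\dim U}\right\rceil . \]
   Context: For a group $G$, a finite-dimensional complex representation $\rho\colon G\to\mathrm{GL}(V)$ and a linear subspace $U\leq V$, the $G$-additive diameter of $V$ with respect to $U$ is \[ \mathrm{diam}_+^G(V,U)=\min\{d \mid \rho(g_1)\cdot U+\dots+\rho(g_d)\cdot U=V \text{ for some } g_1,\dots,g_d\in G\}, \] with value $\infty$ if no such $d$ exists. *)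

(* Defs.v *)
From HB Require Import structures.
From mathcomp Require Import all_boot all_order all_algebra.
From mathcomp Require Import mpoly complex boolp reals.

Set Implicit Arguments.
Unset Strict Implicit.
Unset Printing Implicit Defensive.

Import GRing.Theory.
Local Open Scope ring_scope.

Section SpecialLinear.
Variables (n : nat) (F : fieldType).

Definition SL := {A : 'M[F]_n | \det A == 1}.

HB.instance Definition _ := SubChoice.on SL.

Implicit Types A B : SL.

Lemma det_SL A : \det (val A) = 1.
Proof. exact/eqP/(valP A). Qed.

Lemma SL_unitmx A : val A \in unitmx.
Proof. by rewrite unitmxE det_SL unitr1. Qed.

Fact SL_one_subproof : \det (1%:M : 'M[F]_n) == 1.
Proof. by rewrite det1. Qed.

Fact SL_mul_subproof A B : \det (val A *m val B) == 1.
Proof. by rewrite det_mulmx !det_SL mulr1. Qed.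

Fact SL_inv_subproof A : \det (invmx (val A)) == 1.
Proof. by rewrite det_inv det_SL invr1. Qed.

Definition SL_one : SL := Sub 1%:M SL_one_subproof.
Definition SL_mul A B : SL := Sub (val A *m val B) (SL_mul_subproof A B).
Definition SL_inv A : SL := Sub (invmx (val A)) (SL_inv_subproof A).

Fact SL_mulA : associative SL_mul.
Proof. by move=> A B C; apply/val_inj; rewrite /= mulmxA. Qed.
Fact SL_mul1 : left_id SL_one SL_mul.
Proof. by move=> A; apply/val_inj; rewrite /= mul1mx. Qed.
Fact SL_mulr1 : right_id SL_one SL_mul.
Proof. by move=> A; apply/val_inj; rewrite /= mulmx1. Qed.
Fact SL_mulV : left_inverse SL_one SL_inv SL_mul.
Proof. by move=> A; apply/val_inj; rewrite /= mulVmx ?SL_unitmx. Qed.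
Fact SL_mulrV : right_inverse SL_one SL_inv SL_mul.
Proof. by move=> A; apply/val_inj; rewrite /= mulmxV ?SL_unitmx. Qed.

HB.instance Definition _ :=
  isGroup.Build SL SL_mulA SL_mul1 SL_mulr1 SL_mulV SL_mulrV.

End SpecialLinear.

Section Representations.
Variables (G : groupType) (F : fieldType) (V : vectType F).

(* The two axioms force each [rho g] to be invertible, with inverse            *)
(* [rho g^-1]: this is exactly a group homomorphism from G to GL(V).           *)
Record representation := Representation {
  rep_fun :> G -> 'End(V);
  rep1 : rep_fun 1%g = \1%VF;
  repM : forall g h : G, rep_fun (g * h)%g = (rep_fun g \o rep_fun h)%VF
}.

Variable rho : representation.

Definition rep_stable (W : {vspace V}) : Prop :=
  forall g : G, (rho g @: W <= W)%VS.

Definition rep_irreducible : Prop :=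
  {:V}%VS <> 0%VS /\
  forall W : {vspace V}, rep_stable W -> W = 0%VS \/ W = {:V}%VS.

Definition translates_span (U : {vspace V}) (d : nat) : Prop :=
  exists g : 'I_d -> G, (\sum_(i < d) (rho (g i) @: U))%VS = {:V}%VS.

(* [None] stands for the value infinity. *)
Definition add_diam (U : {vspace V}) : option nat :=
  if pselect (exists d, `[< translates_span U d >]) is left ex_d
  then Some (ex_minn ex_d) else None.

End Representations.

(* Morphism of varieties from SL_n to GL(V): the regular functions on SL_n are *)
(* the restrictions of polynomials in the n * n matrix entries, and it is      *)
(* enough to test the linear functions on End(V), as 1 / det (rho g) is        *)
(* det (rho g^-1), where the entries of g^-1 are polynomial in those of g.     *)
Definition rep_algebraic (n : nat) (F : fieldType) (V : vectType F)
    (rho : representation (SL n F) V) : Prop :=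
  forall (phi : 'Hom(V, F^o)) (v : V), exists p : {mpoly F[n * n]},
    forall g : SL n F, phi (rho g v) = p.@[fun k => mxvec (val g) 0 k].

(* Main.v *)
From HB Require Import structures.
Require Import Defs.
From mathcomp Require Import all_boot all_order all_algebra.
From mathcomp Require Import complex reals mpoly boolp zify ring.

(** Let [N = dim V] and [k = dim U]; the point is that [d] translates of [U]
    span [V] as soon as [N <= d k].  Coordinates are row vectors, so the
    matrix [M] of [rho] satisfies [M (g h) = M h *m M g].

    A vector [v] of weight [c] fixed by all [up r] gives a polynomial curve
    [v M(um s) = \sum_i s^i v_i], and the Bruhat big cell shows that
    [SL_2] acts on it, up to scalars, by Moebius transformations of [s].
    Hence the [v_i] span a stable subspace, so they form a basis, in which the
    unipotents act by the matrices of [p |-> p(X + s)], the torus by distinct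
    weights and the Weyl element by an antidiagonal matrix.

    Spanning is an open condition, so [U] may be replaced by its limit under
    the torus, the span of the [v_i] with [i] in the set [I] of pivots of [U].
    Translating this by [w * um 1] and passing to the limit once more gives the
    span of [v_0, ..., v_(k-1)]: this uses that a polynomial with [m]
    monomials is not divisible by [(X + 1)^m].  Finally the translates of
    the latter by [um s_1, ..., um s_d] span, because a polynomial of degree
    less than [N] does not vanish to order [k] at [d] points. *)

Import Order.TTheory GRing.Theory Num.Theory VectorInternalTheory.
Local Open Scope ring_scope.

Set Implicit Arguments.
Unset Strict Implicit.
Unset Printing Implicit Defensive.

(** * Polynomials *)

Section PolynomialFacts.
Variable F : numFieldType.
Implicit Types p q r : {poly F}.

Lemma poly_eq0_horner p : (forall s, p.[s] = 0) -> p = 0.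
Proof.
move=> p0; apply/eqP/negPn/negP => pN0.
(* In characteristic 0 the integers below [size p] would be too many distinct roots. *)
suff : (size [seq i%:R : F | i <- iota 0 (size p)] < size p)%N.
  by rewrite size_map size_iota ltnn.
apply: max_poly_roots => //; first by apply/allP=> x _; rewrite rootE p0.
by rewrite map_inj_uniq ?iota_uniq //; apply: mulrIn; exact: oner_neq0.
Qed.

Lemma horner_exists_neq0 p : p != 0 -> exists s, p.[s] != 0.
Proof.
move=> pN0; apply: contrapT => h; case/eqP: pN0; apply: poly_eq0_horner => s.
by apply/eqP/negPn/negP => ps; apply: h; exists s.
Qed.

(* The values at the roots of the nonzero polynomial [r] are irrelevant. *)
Lemma mx_poly_eq0 (m k n : nat) (a : nat -> 'M[F]_(m, k)) r : r != 0 ->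
  (forall s, r.[s] != 0 -> \sum_(i < n) s ^+ i *: a i = 0) ->
  forall i, (i < n)%N -> a i = 0.
Proof.
move=> rN0 a0 i lt_in; apply/matrixP => x y; rewrite mxE.
pose p := \poly_(j < n) a j x y.
suff /eqP : r * p = 0.
  by rewrite mulf_eq0 (negPf rN0) => /eqP/(congr1 (coefp i)); rewrite /= coef_poly lt_in coef0.
apply: poly_eq0_horner => s; rewrite hornerM.
have [->|rs] := eqVneq r.[s] 0; first by rewrite mul0r.
have /matrixP/(_ x y) := a0 s rs.
rewrite horner_poly summxE mxE => e; rewrite [X in _ * X](_ : _ = 0) ?mulr0 //.
by rewrite -[RHS]e; apply: eq_bigr => j _; rewrite mxE mulrC.
Qed.

(* If [e0] is an exponent of [q] then [X q' - e0 q] has one monomial less, *)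
(* while the multiplicity of the root [a] drops by at most one. *)
Lemma sparse_poly_eq0 (a : F) (s : seq nat) q : a != 0 ->
  (forall e, q`_e != 0 -> e \in s) -> ('X - a%:P) ^+ size s %| q -> q = 0.
Proof.
move=> aN0; elim: s q => [|e0 s IHs] q supp_q.
  move=> _; apply/polyP => e; rewrite coef0; apply/eqP/negPn/negP.
  by move/supp_q; rewrite in_nil.
move=> /= /dvdpP[h def_q].
have q1_coef e : ('X * q^`() - e0%:R *: q)`_e = (e%:R - e0%:R) * q`_e.
  rewrite coefB coefZ coefXM coef_deriv mulrBl !mulr_natl.
  by case: e => [|e].
have q1_0 : 'X * q^`() - e0%:R *: q = 0.
  apply: IHs => [e|].
    rewrite q1_coef mulf_eq0 negb_or subr_eq0 eqr_nat => /andP[ne /supp_q].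
    by rewrite inE (negPf ne).
  have dv : ('X - a%:P) ^+ size s %| q by rewrite def_q exprS mulrA dvdp_mull.
  apply: dvdp_sub; last by rewrite -mul_polyC dvdp_mull.
  rewrite dvdp_mull // def_q derivM deriv_exp /= dvdp_add //.
    by rewrite exprS mulrA dvdp_mull.
  by rewrite -mulrnAl mulrA dvdp_mull.
(* Only the monomial of exponent [e0] can survive, and it does not vanish at [a] unless its
   coefficient is 0. *)
have q_mono : q = q`_e0 *: 'X^e0.
  apply/polyP => e; rewrite coefZ coefXn.
  have [->|ne] := eqVneq e e0; first by rewrite mulr1.
  have := q1_coef e; rewrite q1_0 coef0 mulr0 => /esym/eqP.
  by rewrite mulf_eq0 subr_eq0 eqr_nat (negPf ne) => /eqP.
have : q.[a] = 0 by rewrite def_q exprS !hornerM hornerXsubC subrr mul0r mulr0.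
rewrite q_mono !hornerE => /eqP; rewrite mulf_eq0 expf_eq0 (negPf aN0) andbF orbF.
by move=> /eqP ->; rewrite scale0r.
Qed.

(** Powers of distinct linear factors are coprime, so their product divides [q]; its size
    [(size ss * k).+1] is too large unless [q] is 0. *)
Lemma horner_eqmod_poly_eq0 (k : nat) (ss : seq F) q : uniq ss ->
  (forall s, s \in ss -> ('X - s%:P) ^+ k %| q) ->
  (size q <= size ss * k)%N -> q = 0.
Proof.
move=> uss dv sz; apply/eqP/negPn/negP => qN0.
have dvs : \prod_(s <- ss) ('X - s%:P) ^+ k %| q.
  elim: ss uss dv {sz} => [|s ss IHs] /=; first by rewrite big_nil dvd1p.
  case/andP=> s_ss uss dv; rewrite big_cons Gauss_dvdp.
    rewrite dv ?mem_head //=; apply: IHs => // t t_ss.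
    by apply: dv; rewrite inE t_ss orbT.
  rewrite coprimep_expl // big_seq.
  apply: (big_ind (coprimep ('X - s%:P))) => [|x y cx cy|t t_ss].
  - exact: coprimep1.
  - by rewrite coprimepMr cx.
  rewrite coprimep_expr // coprimep_XsubC rootE !hornerE subr_eq0.
  by apply: contra s_ss => /eqP <-.
have := leq_trans (dvdp_leq qN0 dvs) sz.
rewrite size_prod_seq; last by move=> s _; rewrite expf_neq0 // polyXsubC_eq0.
rewrite (eq_bigr (fun=> k.+1)) => [|s _]; last by rewrite size_exp_XsubC.
rewrite big_const_seq count_predT iter_addn_0 mulSn -addnS addKn mulnC.
by rewrite ltnn.
Qed.

End PolynomialFacts.

(** * Pivots and binomial matrices *)

Section MatrixFacts.
Variables (F : fieldType) (n : nat).

(** Dual test for inclusion of row spaces, applied to the columns of the cokernel of [B]. Below, the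
    column [f] is read as a polynomial that has to vanish. *)
Lemma submx_cker (m p : nat) (A : 'M[F]_(m, n)) (B : 'M_(p, n)) :
  (forall f : 'cV_n, B *m f = 0 -> A *m f = 0) -> (A <= B)%MS.
Proof.
move=> AB; rewrite submxE; apply/eqP/matrixP => i j.
have /AB/matrixP/(_ i 0) : B *m col j (cokermx B) = 0.
  by rewrite colE mulmxA mulmx_coker mul0mx.
by rewrite colE mulmxA -colE !mxE.
Qed.

Lemma rVpolyE (v : 'rV[F]_n) : rVpoly v = \sum_(j < n) v 0 j *: 'X^j.
Proof.
rewrite [in LHS](row_sum_delta v) linear_sum /=.
by apply: eq_bigr => j _; rewrite linearZ /= rVpoly_delta.
Qed.

Lemma dvdp_Xn k (p : {poly F}) : (forall i, (i < k)%N -> p`_i = 0) -> 'X^k %| p.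
Proof.
move=> p0; rewrite -(poly_take_drop k p) (_ : take_poly k p = 0) ?add0r ?dvdp_mull //.
by apply/polyP=> i; rewrite coef_take_poly coef0; case: ifP => // /p0.
Qed.

(** Serves both as the subspace spanned by the basis vectors in [I], its row space, and as the
    projection onto it, by right multiplication. *)
Definition coordmx (I : {set 'I_n}) : 'M[F]_n :=
  \matrix_(i, j) ((i == j) && (i \in I))%:R.

Lemma mul_coordmx m (A : 'M[F]_(m, n)) I i j :
  (A *m coordmx I) i j = A i j *+ (j \in I).
Proof.
rewrite mxE (bigD1 j) //= mxE eqxx /= mulr_natr big1 ?addr0 // => k /negPf kj.
by rewrite mxE kj mulr0.
Qed.

Lemma coordmx_mul m (A : 'M[F]_(n, m)) I i j :
  (coordmx I *m A) i j = A i j *+ (i \in I).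
Proof.
rewrite mxE (bigD1 i) //= mxE eqxx /= mulr_natl big1 ?addr0 // => k /negPf ki.
by rewrite mxE eq_sym ki mul0r.
Qed.

Lemma rank_coordmx I : \rank (coordmx I) = #|I|.
Proof.
pose E : 'M[F]_(#|I|, n) := rowsub (fun i => enum_val i) 1%:M.
have EEt : E *m E^T = 1%:M.
  apply/matrixP => i j; rewrite !mxE (bigD1 (enum_val i)) //= !mxE eqxx mul1r.
  rewrite big1 ?addr0 => [|k /negPf ki]; last by rewrite !mxE eq_sym ki mul0r.
  by rewrite (inj_eq enum_val_inj) eq_sym.
have EI : E *m coordmx I = E.
  apply/matrixP => i j; rewrite mul_coordmx !mxE.
  by case: eqP => [<-|_]; rewrite ?enum_valP ?mul0rn.
apply/eqP; rewrite eqn_leq; apply/andP; split; last first.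
  rewrite -[X in (X <= _)%N](@mxrank1 F) -EEt.
  apply: leq_trans (mxrankM_maxl _ _) _.
  by rewrite -EI mxrankM_maxr.
rewrite (_ : coordmx I = E^T *m E); first exact: leq_trans (mxrankM_maxr _ _) (rank_leq_row _).
apply/matrixP => i j; rewrite !mxE.
under eq_bigr do rewrite !mxE.
have [iI|iI] := boolP (i \in I); last first.
  rewrite andbF big1 // => k _; case: eqP => [e|]; rewrite ?mul0r //.
  by rewrite -e enum_valP in iI.
rewrite (bigD1 (enum_rank_in iI i)) //= enum_rankK_in // eqxx mul1r andbT.
rewrite big1 ?addr0 // => k ki; case: eqP => [e|]; rewrite ?mul0r //.
by case/eqP: ki; apply: enum_val_inj; rewrite enum_rankK_in.
Qed.

(* The leading positions of the nonzero vectors of the row space of [A], i.e. *)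
(* the pivots of its reduced row echelon form. *)
Definition pivots (A : 'M[F]_n) : {set 'I_n} :=
  [set i | `[< exists x : 'rV_n,
    [/\ (x <= A)%MS, x 0 i = 1 & forall j : 'I_n, (j < i)%N -> x 0 j = 0] >]].

Lemma pivotP (A : 'M[F]_n) (x : 'rV_n) : (x <= A)%MS -> x != 0 ->
  exists2 i, i \in pivots A & x 0 i != 0.
Proof.
move=> xA xN0; have [i0 xi0] : exists i, x 0 i != 0.
  apply: contrapT => h; case/eqP: xN0; apply/rowP => i; rewrite mxE.
  by apply/eqP/negPn/negP => xi; apply: h; exists i.
have [i xi min_i] := @arg_minnP _ i0 (fun i => x 0 i != 0) (@nat_of_ord n) xi0.
exists i => //; rewrite inE; apply/asboolP; exists ((x 0 i)^-1 *: x).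
split; [exact: scalemx_sub | by rewrite mxE mulVf|].
move=> j ji; rewrite mxE; have [->|/min_i] := eqVneq (x 0 j) 0; first by rewrite mulr0.
by rewrite leqNgt ji.
Qed.

(** Projection to the pivot coordinates is injective on the row space, since the leading position of
    a nonzero vector is a pivot. *)
Lemma rank_le_pivots (A : 'M[F]_n) : (\rank A <= #|pivots A|)%N.
Proof.
rewrite -rank_coordmx -(mxrank_mul_ker A (coordmx (pivots A))).
rewrite [X in (_ + X)%N](_ : _ = 0)%N ?addn0 ?mxrankM_maxr //.
apply/eqP; rewrite mxrank_eq0; apply/rowV0Pn => -[x].
rewrite sub_capmx => /andP[xA /sub_kermxP xE] /(pivotP xA)[i iA /negP[]].
have /rowP/(_ i) := xE; rewrite mul_coordmx iA mulr1n [RHS]mxE => ->; exact: eqxx.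
Qed.

End MatrixFacts.

Lemma card_ord_lt (n k : nat) : (k <= n)%N -> #|[set i : 'I_n | (i < k)%N]| = k.
Proof.
move=> kn; have inj : injective (widen_ord kn) by move=> i j [/val_inj].
rewrite -[RHS](card_ord k) -(card_imset _ inj).
apply: eq_card => i; rewrite inE; apply/idP/imsetP => [ik|[j _ ->] //=].
by exists (Ordinal ik) => //; apply: val_inj.
Qed.

Section BinomialMatrix.
Variables (F : numFieldType) (n : nat).

(* The matrix of [p |-> p(X + s)] in the basis of monomials. *)
Definition shiftmx (s : F) : 'M[F]_n :=
  \matrix_(i, j) (s ^+ (j - i) *+ 'C(j, i)).

Lemma coef_XaddC_exp (s : F) j i :
  (('X + s%:P) ^+ j)`_i = s ^+ (j - i) *+ 'C(j, i).
Proof.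
rewrite addrC exprDn coef_sum; have [ij|ij] := leqP i j.
  rewrite (bigD1 (Ordinal (ij : (i < j.+1)%N))) //= big1 ?addr0 => [|k ki].
    by rewrite coefMn -rmorphXn /= coefCM coefXn eqxx mulr1.
  rewrite coefMn -rmorphXn /= coefCM coefXn (_ : _ == _ = false) ?mulr0 ?mul0rn //.
  by apply: contraNF ki => /eqP e; apply/eqP/val_inj.
rewrite bin_small // mulr0n big1 // => k _.
rewrite coefMn -rmorphXn /= coefCM coefXn (_ : _ == _ = false) ?mulr0 ?mul0rn //.
by apply/gtn_eqF/(leq_ltn_trans _ ij); rewrite -ltnS.
Qed.

Lemma shiftmx_mul (s : F) (f : 'cV_n) (i : 'I_n) :
  (shiftmx s *m f) i 0 = (rVpoly f^T \Po ('X + s%:P))`_i.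
Proof.
rewrite rVpolyE linear_sum coef_sum mxE; apply: eq_bigr => j _.
by rewrite linearZ /= rmorphXn /= comp_polyX coefZ coef_XaddC_exp !mxE mulrC.
Qed.

(** A column supported on the last [#|I|] coordinates is a polynomial divisible by ['X^(n - #|I|)].
    If its shift has no monomial in [I], this shift has at most [n - #|I|] monomials and is
    divisible by the power [n - #|I|] of ['X + 1], hence is 0. So the minor with rows [I] and these
    columns is nonsingular. *)
Lemma rank_coord_shift (I : {set 'I_n}) :
  \rank (coordmx F I *m shiftmx 1 *m coordmx F [set j : 'I_n | n - #|I| <= j]%N) = #|I|.
Proof.
set J := [set j | _]; have I_n : (#|I| <= n)%N by have := max_card (mem I); rewrite card_ord.
have cJ : #|J| = #|I|.
  rewrite cardsCs (_ : ~: J = [set i : 'I_n | i < n - #|I|]%N).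
    by rewrite card_ord_lt ?leq_subr // card_ord subKn.
  by apply/setP => j; rewrite !inE -ltnNge.
apply/eqP; rewrite eqn_leq; apply/andP; split.
  by rewrite -mulmxA (leq_trans (mxrankM_maxl _ _)) ?rank_coordmx.
rewrite -cJ -(rank_coordmx F J); apply: mxrankS; apply: submx_cker => f.
rewrite -mulmxA; set g := coordmx F J *m f => g0.
have gJ j : j \notin J -> g j 0 = 0 by move=> /negPf jJ; rewrite coordmx_mul jJ.
pose p := rVpoly g^T; pose q := p \Po ('X + 1%:P).
have dvp : 'X^(n - #|I|) %| p.
  apply: dvdp_Xn => i iI; have i_n := leq_trans iI (leq_subr _ _).
  have -> : i = Ordinal i_n by [].
  by rewrite coef_rVpoly_ord mxE gJ // inE -ltnNge.
suff q0 : q = 0.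
  apply/colP => j; rewrite [RHS]mxE.
  have : p = 0 by rewrite -(comp_polyXaddC_K p 1) -/q q0 comp_poly0.
  by move=> /(congr1 (coefp j)); rewrite /= coef0 coef_rVpoly_ord mxE.
apply: (@sparse_poly_eq0 F (-1) [seq val i | i <- enum (~: I)]).
- by rewrite oppr_eq0 oner_eq0.
- move=> e qe; have e_n : (e < n)%N.
    rewrite ltnNge; apply: contra qe => ne; rewrite nth_default //.
    rewrite size_comp_poly2 ?size_XaddC //; exact: leq_trans (size_poly _ _) ne.
  apply/mapP; exists (Ordinal e_n) => //; rewrite mem_enum inE.
  apply: contra qe => eI; have /colP/(_ (Ordinal e_n)) := g0.
  by rewrite -mulmxA coordmx_mul eI shiftmx_mul mxE mulr1n => /eqP.
rewrite size_map -cardE cardsCs setCK card_ord rmorphN /= opprK.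
by have := dvdp_comp_poly ('X + 1%:P) dvp; rewrite rmorphXn /= comp_polyX.
Qed.

End BinomialMatrix.

(** * Translates of a subspace in the standard model *)

Section Translates.
Variables (F : numFieldType) (n : nat) (G : groupType) (M : G -> 'M[F]_n).
Hypothesis M1 : M 1%g = 1%:M.
Hypothesis MM : forall g h, M (g * h)%g = M h *m M g.

Definition mx_translates_span d (A : 'M[F]_n) : Prop :=
  exists g : 'I_d -> G, row_full (\sum_i A *m M (g i))%MS.

Lemma mx_translates_spanS d A B :
  (A <= B)%MS -> mx_translates_span d A -> mx_translates_span d B.
Proof.
move=> AB [g gA]; exists g; rewrite -!sub1mx in gA *; apply: submx_trans gA _.
by apply/sumsmx_subP => i _; rewrite (sumsmx_sup i) // submxMr.
Qed.

Lemma mx_translates_spanM d A h :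
  mx_translates_span d (A *m M h) -> mx_translates_span d A.
Proof.
move=> [g gA]; exists (fun i => (g i * h)%g).
by under eq_bigr do rewrite MM mulmxA.
Qed.

(* If the translates of [B 0] span then some polynomial in [t], a determinant *)
(* of a combination of translates of [B t], takes the value 1 at 0. *)
Lemma mx_translates_span_deform d (B : 'M[{poly F}]_n) :
  mx_translates_span d (map_mx (horner^~ 0) B) ->
  exists2 t, t != 0 & mx_translates_span d (map_mx (horner^~ t) B).
Proof.
move=> [g]; rewrite -sub1mx => /sub_sumsmxP[C def1].
pose D := \sum_i map_mx polyC (C i) *m (B *m map_mx polyC (M (g i))).
have evD t : map_mx (horner_eval t) D =
    \sum_i C i *m (map_mx (horner^~ t) B *m M (g i)).
  rewrite raddf_sum; apply: eq_bigr => i _; rewrite /= !map_mxM.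
  have polyCK (A : 'M[F]_n) : map_mx (horner_eval t) (map_mx polyC A) = A.
    by apply/matrixP => x y; rewrite !mxE /horner_eval hornerC.
  by rewrite !polyCK.
have detD t : (\det D).[t] = \det (\sum_i C i *m (map_mx (horner^~ t) B *m M (g i))).
  by rewrite -evD det_map_mx.
have D0 : (\det D).[0] = 1 by rewrite detD -def1 det1.
(* The factor ['X] makes the point found below nonzero as well. *)
have : 'X * \det D != 0.
  rewrite mulf_neq0 ?polyX_eq0 //; apply: contra_eqN D0 => /eqP ->.
  by rewrite horner0 eq_sym oner_eq0.
case/horner_exists_neq0 => t; rewrite hornerM hornerX mulf_eq0 negb_or.
case/andP => tN0; rewrite detD => Dt; exists t => //; exists g.
set S := (\sum_i _)%MS; rewrite -col_leq_rank.
move: Dt; rewrite -unitfE -unitmxE => /mxrank_unit/esym/eq_leq rkE.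
by apply: leq_trans rkE _; apply: mxrankS; apply/sub_sumsmxP; exists C.
Qed.

Hypothesis torus : forall t, t != 0 ->
  exists g c, c != 0 /\ M g = diag_mx (\row_j (c * t ^+ j.*2)).

(** The torus multiplies coordinate [j] by [t ^+ j.*2], up to a common scalar. Dividing the
    translate of a vector with pivot [i] by its leading weight gives a family polynomial in [t]
    whose value at 0 is the basis vector of index [i]. *)
Lemma mx_translates_span_pivots d A :
  mx_translates_span d (coordmx F (pivots A)) -> mx_translates_span d A.
Proof.
move=> span_piv.
have [x xP] : exists x : 'I_n -> 'rV[F]_n, forall i, i \in pivots A ->
    [/\ (x i <= A)%MS, x i 0 i = 1 & forall j : 'I_n, (j < i)%N -> x i 0 j = 0].
  apply: (@fin_all_exists _ _ (fun i y => i \in pivots A ->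
    [/\ (y <= A)%MS, y 0 i = 1 & forall j : 'I_n, (j < i)%N -> y 0 j = 0])) => i.
  have [iA|] := boolP (i \in pivots A); last by exists 0.
  by move: (iA); rewrite inE => /asboolP[y yP]; exists y.
pose B : 'M[{poly F}]_n := \matrix_(i, j)
  (if (i \in pivots A) && (i <= j)%N then (x i 0 j)%:P * 'X^((j - i).*2) else 0).
have [|t tN0] := @mx_translates_span_deform d B.
  rewrite (_ : map_mx _ _ = coordmx F (pivots A)) //.
  apply/matrixP => i j; rewrite !mxE; have [iA|] := boolP (i \in pivots A); last first.
    by rewrite andbF horner0.
  have [_ xi1 xi0] := xP i iA; rewrite andbT /=; case: ltngtP => [ij|ji|/val_inj <-].
  - rewrite hornerM hornerXn expr0n double_eq0 subn_eq0 leqNgt ij mulr0.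
    by rewrite (_ : i == j = false) //; apply/eqP => e; rewrite e ltnn in ij.
  - by rewrite horner0 (_ : i == j = false) //; apply/eqP => e; rewrite e ltnn in ji.
  by rewrite subnn mulr1 hornerC xi1 eqxx.
have [h [c [cN0 defM]]] := torus tN0.
move=> spanB; apply: (@mx_translates_spanM _ _ h); apply: mx_translates_spanS spanB.
apply/row_subP => i; have [iA|iA] := boolP (i \in pivots A); last first.
  rewrite (_ : row i _ = 0) ?sub0mx //; apply/rowP => j.
  by rewrite !mxE (negPf iA) horner0.
have [xiA xi1 xi0] := xP i iA.
rewrite (_ : row i _ = (c * t ^+ i.*2)^-1 *: (x i *m M h)).
  by rewrite scalemx_sub // submxMr.
have xiM j : (x i *m M h) 0 j = x i 0 j * (c * t ^+ j.*2).
  by rewrite defM mul_mx_diag !mxE.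
apply/rowP => j; rewrite [RHS]mxE xiM !mxE iA /=.
case: leqP => [ij|ji]; last by rewrite horner0 xi0 // mul0r mulr0.
rewrite hornerM hornerC hornerXn mulrCA; congr (_ * _).
have -> : j.*2 = ((j - i).*2 + i.*2)%N by lia.
by rewrite exprD invfM mulrACA mulVf // mul1r mulrC mulfK // expf_neq0.
Qed.

Hypothesis unipotent : forall s, exists g, M g = shiftmx n s.
Hypothesis weyl : exists g, exists e : 'I_n -> F, (forall i, e i != 0) /\
  M g = \matrix_(i, j) (e i *+ (j == rev_ord i)).

(** A column killed by the translates under the shifts by [0, ..., d - 1] is a polynomial of size at
    most [n] that vanishes to order [k] at [d] distinct points. *)
Lemma mx_translates_span_first d k : (n <= d * k)%N ->
  mx_translates_span d (coordmx F [set i : 'I_n | i < k]%N).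
Proof.
move=> n_dk; have [g gE] := fin_all_exists (fun i : 'I_d => unipotent i%:R).
exists g; rewrite -sub1mx; apply: submx_cker => f Sf.
have gf (i : 'I_d) (j : 'I_n) : (j < k)%N ->
    (rVpoly f^T \Po ('X + (i%:R)%:P))`_j = 0.
  move=> jk; rewrite -shiftmx_mul -gE.
  have : (coordmx F [set i : 'I_n | i < k]%N *m M (g i) *m f) j 0 = 0.
    have /submxP[D ->] : (coordmx F [set i : 'I_n | (i < k)%N] *m M (g i)
       <= \sum_i coordmx F [set i : 'I_n | (i < k)%N] *m M (g i))%MS.
      exact: (sumsmx_sup i).
    by rewrite -mulmxA Sf mulmx0 mxE.
  by rewrite -mulmxA coordmx_mul inE jk mulr1n.
suff p0 : rVpoly f^T = 0.
  rewrite mul1mx; apply/colP => j; have := congr1 (coefp j) p0.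
  by rewrite /= coef0 coef_rVpoly_ord !mxE.
apply: (@horner_eqmod_poly_eq0 _ k [seq (val i)%:R | i : 'I_d]).
- rewrite map_inj_uniq ?enum_uniq // => i j /eqP; rewrite eqr_nat => /eqP.
  exact: val_inj.
- move=> _ /mapP[i _ ->].
  have dv : 'X^k %| rVpoly f^T \Po ('X + (i%:R)%:P).
    apply: dvdp_Xn => j jk; have [j_n|n_j] := ltnP j n.
      exact: (gf i (Ordinal j_n)).
    rewrite nth_default // size_comp_poly2 ?size_XaddC //.
    exact: leq_trans (size_poly _ _) n_j.
  have := dvdp_comp_poly ('X - (i%:R)%:P) dv.
  by rewrite comp_polyXaddC_K rmorphXn /= comp_polyX.
by rewrite size_map -cardE card_ord (leq_trans (size_poly _ _)).
Qed.

(** By [rank_coord_shift], a vector of [coordmx I *m M u] is determined by its last [#|I|]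
    coordinates. The Weyl element carries these to the first positions, so the new pivots lie among
    the first [#|I|] and, by their number, fill them. *)
Lemma mx_translates_span_rank d (U : 'M[F]_n) :
  (n <= d * \rank U)%N -> mx_translates_span d U.
Proof.
move=> n_dU; apply: mx_translates_span_pivots; set I := pivots U.
have n_dI : (n <= d * #|I|)%N.
  by apply: leq_trans n_dU _; rewrite leq_mul2l rank_le_pivots orbT.
have I_n : (#|I| <= n)%N by have := max_card (mem I); rewrite card_ord.
have [u uE] := unipotent 1; have [w [e [eN0 wE]]] := weyl.
have Munit g : M g \in unitmx.
  by case: (@mulmx1_unit _ _ (M g) (M (g^-1)%g)) => //; rewrite -MM mulVg.
apply: (mx_translates_spanM (h := u)); apply: (mx_translates_spanM (h := w)).
apply: mx_translates_span_pivots; set A := _ *m M w.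
suff -> : pivots A = [set i : 'I_n | i < #|I|]%N by exact: mx_translates_span_first.
have rkA : \rank (coordmx F I *m M u) = #|I|.
  by rewrite mxrankMfree ?rank_coordmx // row_free_unit.
apply/eqP; rewrite eqEcard card_ord_lt //; apply/andP; split; last first.
  apply: leq_trans (rank_le_pivots A).
  by rewrite mxrankMfree ?row_free_unit // rkA.
apply/subsetP => i; rewrite inE => /asboolP[x [/submxP[y ->] xi xj]].
rewrite inE ltnNge; apply/negP => Ii; move: xi.
set z := y *m (coordmx F I *m M u).
have zE j : (y *m A) 0 j = z 0 (rev_ord j) * e (rev_ord j).
  rewrite mulmxA -/z wE mxE (bigD1 (rev_ord j)) //= mxE rev_ordK eqxx big1 ?addr0 // => l lj.
  rewrite mxE (_ : (j == _) = false) ?mulr0n ?mulr0 //; apply: contraNF lj => /eqP ->.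
  by rewrite rev_ordK.
suff z0 : z = 0 by rewrite zE z0 mxE mul0r => /eqP; rewrite eq_sym oner_eq0.
pose J := [set j : 'I_n | n - #|I| <= j]%N.
have zJ : z *m coordmx F J = 0.
  apply/rowP => j; rewrite mul_coordmx [RHS]mxE inE; case: leqP => // jJ; rewrite mulr1n.
  have := zE (rev_ord j); rewrite xj ?rev_ordK; last first.
    by move: jJ Ii I_n (ltn_ord j) => /=; move: #|I| => k; lia.
  by move/eqP; rewrite eq_sym mulf_eq0 (negPf (eN0 _)) orbF => /eqP.
(* The projection onto [J] preserves the rank, so its kernel meets the row space trivially. *)
have := mxrank_mul_ker (coordmx F I *m M u) (coordmx F J).
rewrite {1}uE rank_coord_shift rkA => /eqP; rewrite -{2}[#|I|]addn0 eqn_add2l.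
rewrite mxrank_eq0 => /eqP capE0; apply/eqP; rewrite -submx0 -capE0 sub_capmx.
by rewrite submxMl; apply/sub_kermxP.
Qed.

End Translates.

(** * Generators of SL_2 *)

Section SL2.
Variable F : fieldType.

Definition mx22 (a b c d : F) : 'M[F]_2 :=
  \matrix_(i, j) if i == 0 then if j == 0 then a else b
                 else if j == 0 then c else d.

(* Junk value: the identity, unless [a * d - b * c = 1]. *)
Definition sl2 (a b c d : F) : SL 2 F := insubd (1%g : SL 2 F) (mx22 a b c d).

Section Entries.
Variables a b c d : F.
Hypothesis abcd : a * d - b * c = 1.

Lemma val_sl2 : val (sl2 a b c d) = mx22 a b c d.
Proof.
rewrite val_insubd (_ : _ == 1) // (expand_det_row _ 0) !big_ord_recl big_ord0.
by rewrite /cofactor !det_mx11 !mxE /= mul1r mulN1r mulrN addr0 abcd.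
Qed.

Lemma sl2_00 : val (sl2 a b c d) 0 0 = a. Proof. by rewrite val_sl2 mxE. Qed.
Lemma sl2_01 : val (sl2 a b c d) 0 1 = b. Proof. by rewrite val_sl2 mxE. Qed.
Lemma sl2_10 : val (sl2 a b c d) 1 0 = c. Proof. by rewrite val_sl2 mxE. Qed.
Lemma sl2_11 : val (sl2 a b c d) 1 1 = d. Proof. by rewrite val_sl2 mxE. Qed.

End Entries.

Lemma det_SL2 (g : SL 2 F) :
  val g 0 0 * val g 1 1 - val g 0 1 * val g 1 0 = 1.
Proof.
have := det_SL g; move: (val g) => A; rewrite (expand_det_row _ 0) !big_ord_recl.
rewrite big_ord0 /cofactor !det_mx11 !mxE /= mul1r mulN1r mulrN addr0 => <-.
by congr (_ * A _ _ - A _ _ * A _ _); apply: val_inj.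
Qed.

Lemma sl2E (g : SL 2 F) : g = sl2 (val g 0 0) (val g 0 1) (val g 1 0) (val g 1 1).
Proof.
apply: val_inj; rewrite val_sl2 ?det_SL2 //; apply/matrixP => i j; rewrite mxE.
by case: i => [[|[|i]] Hi] //; case: j => [[|[|j]] Hj] //=; congr (val g _ _); apply: val_inj.
Qed.

Lemma sl2M a b c d a' b' c' d' : a * d - b * c = 1 -> a' * d' - b' * c' = 1 ->
  (sl2 a b c d * sl2 a' b' c' d')%g =
  sl2 (a * a' + b * c') (a * b' + b * d') (c * a' + d * c') (c * b' + d * d').
Proof.
move=> h h'; rewrite [LHS]sl2E; congr sl2;
  by rewrite /= mxE !big_ord_recl big_ord0 addr0 !val_sl2 // !mxE.
Qed.

Definition up (s : F) := sl2 1 s 0 1.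
Definition um (s : F) := sl2 1 0 s 1.
Definition tor (t : F) := sl2 t 0 0 t^-1.

Lemma up_det (s : F) : 1 * 1 - s * 0 = 1. Proof. by rewrite mulr0 subr0 mulr1. Qed.
Lemma um_det (s : F) : 1 * 1 - 0 * s = 1. Proof. by rewrite mul0r subr0 mulr1. Qed.
Lemma tor_det (t : F) : t != 0 -> t * t^-1 - 0 * 0 = 1.
Proof. by move=> t0; rewrite mul0r subr0 divff. Qed.

Lemma upM s r : (up s * up r)%g = up (s + r).
Proof. by rewrite sl2M ?up_det //; congr sl2; ring. Qed.

Lemma torM t u : t != 0 -> u != 0 -> (tor t * tor u)%g = tor (t * u).
Proof. by move=> t0 u0; rewrite sl2M ?tor_det //; congr sl2; field; rewrite ?t0 ?u0. Qed.

Lemma up_tor t r : t != 0 -> (up r * tor t)%g = (tor t * up (r / t ^+ 2))%g.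
Proof.
by move=> t0; rewrite !sl2M ?tor_det ?up_det //; congr sl2; field; rewrite ?t0.
Qed.

(* The big cell of the Bruhat decomposition. *)
Lemma mul_um (g : SL 2 F) (s : F) :
  let x := val g 0 0 + val g 0 1 * s in let y := val g 1 0 + val g 1 1 * s in
  x != 0 -> (g * um s = um (y / x) * (tor x * up (val g 0%R 1%R / x)))%g.
Proof.
move=> x y; rewrite /x /y => {x y} a0; rewrite {1}(sl2E g); move: (det_SL2 g) a0.
move: (val g 0 0) (val g 0 1) (val g 1 0) (val g 1 1) => a b c d D a0.
rewrite sl2M ?um_det // [in RHS]sl2M ?tor_det ?up_det // sl2M ?um_det //; last by field.
congr sl2; try by field.
(* Writing 1 as [a * d - b * c] makes the last entry an identity of fractions. *)
transitivity (((c + d * s) * b + (a * d - b * c)) / (a + b * s)); first by field.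
by rewrite D; field.
Qed.

End SL2.

(** * Polynomial families of matrices *)

Section PolynomialFunctions.
Variable F : numFieldType.

(** The functions regular where [D] does not vanish: polynomials for [D = 1], Laurent polynomials
    for [D = 'X]. Values at the roots of [D] are unconstrained. *)
Definition fraction_fun (D : {poly F}) (f : F -> F) : Prop :=
  exists m q, forall s, D.[s] != 0 -> D.[s] ^+ m * f s = q.[s].

Lemma fraction_fun_poly D p : fraction_fun D (horner p).
Proof. by exists 0%N, p => s _; rewrite mul1r. Qed.

Lemma fraction_fun_add D f g : fraction_fun D f -> fraction_fun D g ->
  fraction_fun D (fun s => f s + g s).
Proof.
move=> [m [p fp]] [k [q gq]]; exists (m + k)%N, (D ^+ k * p + D ^+ m * q) => s Ds.
by rewrite hornerD !hornerM !horner_exp -fp // -gq // exprD; ring.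
Qed.

Lemma fraction_fun_mul D f g : fraction_fun D f -> fraction_fun D g ->
  fraction_fun D (fun s => f s * g s).
Proof.
move=> [m [p fp]] [k [q gq]]; exists (m + k)%N, (p * q) => s Ds.
by rewrite hornerM -fp // -gq // exprD mulrACA.
Qed.

(** The class is a ring containing the constants. Thus a matrix polynomial in the entries of [g]
    stays in it along a one-parameter family. *)
Lemma fraction_fun_meval D n (p : {mpoly F[n]}) (v : F -> 'I_n -> F) :
  (forall k, fraction_fun D (v^~ k)) -> fraction_fun D (fun s => p.@[v s]).
Proof.
move=> vD; rewrite (_ : (fun s => _) = fun s =>
    \sum_(m <- msupp p) p@_m * \prod_i v s i ^+ m i); last first.
  by apply/funext => s; rewrite mevalE.
have fraction_fun_const c : fraction_fun D (fun=> c).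
  by exists 0%N, c%:P => s _; rewrite mul1r hornerC.
elim: (msupp p) => [|m ms IHms].
  by rewrite (_ : (fun s => _) = fun=> 0) //; apply/funext => s; rewrite big_nil.
rewrite (_ : (fun s => _) = fun s => p@_m * \prod_i v s i ^+ m i +
  \sum_(j <- ms) p@_j * \prod_i v s i ^+ j i); last by apply/funext => s; rewrite big_cons.
apply: fraction_fun_add => //; apply: fraction_fun_mul => //.
elim: (index_enum _) => [|i s IHs].
  by rewrite (_ : (fun s => _) = fun=> 1) //; apply/funext => s; rewrite big_nil.
rewrite (_ : (fun s => _) = fun t => v t i ^+ m i * \prod_(j <- s) v t j ^+ m j);
  last by apply/funext => t; rewrite big_cons.
apply: fraction_fun_mul => //; elim: (m i) => [|e IHe].
  exact: fraction_fun_const.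
rewrite (_ : (fun s => _) = fun t => v t i * v t i ^+ e); last by apply/funext => t; rewrite exprS.
exact: fraction_fun_mul.
Qed.

Lemma fraction_fun_mx D p q (A : F -> 'M[F]_(p, q)) :
  (forall i j, fraction_fun D (fun s => A s i j)) ->
  exists m n (a : nat -> 'M_(p, q)), forall s, D.[s] != 0 ->
    D.[s] ^+ m *: A s = \sum_(k < n) s ^+ k *: a k.
Proof.
move=> AD; have [m mP] := fin_all_exists (fun x : 'I_p * 'I_q => AD x.1 x.2).
have [f fP] := fin_all_exists mP.
pose mm := (\sum_x m x)%N.
pose g x := D ^+ (mm - m x) * f x.
pose n := (\max_x size (g x))%N.
exists mm, n, (fun k => \matrix_(i, j) (g (i, j))`_k) => s Ds.
apply/matrixP => i j; rewrite mxE summxE.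
under eq_bigr do rewrite !mxE mulrC.
rewrite -horner_coef_wide; last exact: (leq_bigmax (i, j)).
rewrite hornerM horner_exp -fP //= mulrA -exprD subnK //.
by rewrite /mm (bigD1 (i, j)) //= leq_addr.
Qed.

(** Binomial theorem, summed over the full range since ['C(j, i)] is 0 for [j < i]. Comparing
    coefficients of [s] then gives the action of the unipotents. *)
Lemma sum_shift m k n (a : nat -> 'M[F]_(m, k)) s r :
  \sum_(j < n) (s + r) ^+ j *: a j =
  \sum_(i < n) s ^+ i *: \sum_(j < n) (r ^+ (j - i) *+ 'C(j, i)) *: a j.
Proof.
under [RHS]eq_bigr do rewrite scaler_sumr.
rewrite exchange_big /=; apply: eq_bigr => j _.
under eq_bigr do rewrite scalerA.
rewrite -scaler_suml; congr (_ *: _).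
have -> : (s + r) ^+ j = (('X + r%:P) ^+ j).[s] by rewrite horner_exp !hornerE.
rewrite (@horner_coef_wide _ n); last by rewrite -(opprK r) polyCN size_exp_XsubC.
by apply: eq_bigr => i _; rewrite coef_XaddC_exp mulrC.
Qed.

Lemma mx_poly_inj m k n (a b : nat -> 'M[F]_(m, k)) (D : {poly F}) : D != 0 ->
  (forall s, D.[s] != 0 ->
    \sum_(i < n) s ^+ i *: a i = \sum_(i < n) s ^+ i *: b i) ->
  forall i, (i < n)%N -> a i = b i.
Proof.
move=> D0 ab i lt_in; apply/eqP; rewrite -subr_eq0; apply/eqP.
apply: (@mx_poly_eq0 _ _ _ n (fun i => a i - b i) D) => // s Ds.
by under eq_bigr do rewrite scalerBr; rewrite sumrB ab ?subrr.
Qed.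

Lemma mx_poly_trail_eq0 m k n e (a b : nat -> 'M[F]_(m, k)) : (0 < n)%N -> (0 < e)%N ->
  (forall s, s != 0 ->
    \sum_(i < n) s ^+ i *: a i = s ^+ e *: \sum_(i < n) s ^+ i *: b i) ->
  a 0%N = 0.
Proof.
move=> n0 e0 ab.
(* Both sides are padded with zeros to [e + n] coefficients; the right one has constant term 0. *)
pose c i := if (i < n)%N then a i else 0.
pose c' i := if (e <= i < e + n)%N then b (i - e)%N else 0.
have := @mx_poly_inj _ _ (e + n) c c' 'X; rewrite polyX_eq0 => /(_ isT) cc'.
have : c 0%N = c' 0%N.
  apply: cc'; last by rewrite addn_gt0 e0.
  move=> s; rewrite hornerX => s0.
  rewrite -(big_mkord xpredT (fun i => s ^+ i *: c i)).
  rewrite -(big_mkord xpredT (fun i => s ^+ i *: c' i)).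
  rewrite (@big_cat_nat _ _ _ n) ?leq_addl //= [X in _ + X]big_nat_cond.
  rewrite [X in _ + X]big1 ?addr0 => [|i /andP[/andP[ni _] _]]; last first.
    by rewrite /c ltnNge ni scaler0.
  rewrite [RHS](@big_cat_nat _ _ _ e) ?leq_addr //= [X in X + _]big_nat_cond.
  rewrite [X in X + _]big1 ?add0r => [|i /andP[/andP[_ ie] _]]; last first.
    by rewrite /c' leqNgt ie scaler0.
  rewrite [LHS]big_mkord [LHS](_ : _ = \sum_(i < n) s ^+ i *: a i); last first.
    by apply: eq_bigr => i _; rewrite /c ltn_ord.
  rewrite -[X in \big[_/_]_(X <= _ < _) _]add0n big_addn addKn big_mkord.
  rewrite ab // scaler_sumr; apply: eq_bigr => i _.
  by rewrite /c' leq_addl addnC ltn_add2l ltn_ord addKn scalerA exprD.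
by rewrite /c /c' n0 leqNgt e0.
Qed.

End PolynomialFunctions.

(** * The basis generated by a highest weight vector *)

Section MatrixRepresentation.
Variables (F : numFieldType) (N : nat) (M : SL 2 F -> 'M[F]_N).
Hypothesis N_gt0 : (0 < N)%N.
Hypothesis M1 : M 1%g = 1%:M.
Hypothesis MM : forall g h, M (g * h)%g = M h *m M g.
Hypothesis M_poly : forall i j, exists p : {mpoly F[2 * 2]},
  forall g, M g i j = p.@[fun k => mxvec (val g) 0 k].
Hypothesis M_irr : forall W : 'M[F]_N,
  (forall g, (W *m M g <= W)%MS) -> W = 0 \/ row_full W.

Lemma fraction_fun_rep D (g : F -> SL 2 F) :
  (forall i j, fraction_fun D (fun s => val (g s) i j)) ->
  forall i j, fraction_fun D (fun s => M (g s) i j).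
Proof.
move=> gD i j; have [p pM] := M_poly i j.
rewrite (_ : (fun s => _) = fun s => p.@[fun k => mxvec (val (g s)) 0 k]).
  apply: fraction_fun_meval => k; case/mxvec_indexP: k => x y.
  rewrite (_ : (fun s => _) = fun s => val (g s) x y) //.
  by apply/funext => s; rewrite mxvecE.
by apply/funext => s; rewrite pM.
Qed.

Lemma fraction_fun_row D (v : 'rV_N) (g : F -> SL 2 F) :
  (forall i j, fraction_fun D (fun s => val (g s) i j)) ->
  forall i j, fraction_fun D (fun s => (v *m M (g s)) i j).
Proof.
move=> /fraction_fun_rep gD i j.
rewrite (_ : (fun s => _) = fun s => \sum_k v i k * M (g s) k j); last first.
  by apply/funext => s; rewrite mxE.
elim: (index_enum _) => [|k s IHs].
  rewrite (_ : (fun s => _) = horner 0); first exact: fraction_fun_poly.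
  by apply/funext => s; rewrite big_nil horner0.
rewrite (_ : (fun s => _) = fun t => (v i k)%:P.[t] * M (g t) k j +
    \sum_(l <- s) v i l * M (g t) l j); last first.
  by apply/funext => t; rewrite big_cons hornerC.
apply: fraction_fun_add => //; apply: fraction_fun_mul => //.
exact: fraction_fun_poly.
Qed.

(** At the roots of [D] the matrix may be the default value of [sl2], which [fraction_fun]
    ignores. *)
Lemma fraction_fun_sl2 D (a b c d : F -> F) :
  (forall s, D.[s] != 0 -> a s * d s - b s * c s = 1) ->
  fraction_fun D a -> fraction_fun D b -> fraction_fun D c -> fraction_fun D d ->
  forall i j, fraction_fun D (fun s => val (sl2 (a s) (b s) (c s) (d s)) i j).
Proof.
move=> det1 Da Db Dc Dd i j.
have [m [q fq]] : fraction_fun D (fun s => mx22 (a s) (b s) (c s) (d s) i j).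
  rewrite (_ : (fun s => _) = if i == 0 then if j == 0 then a else b
    else if j == 0 then c else d); last first.
    by apply/funext => s; rewrite mxE; do 2 case: (_ == 0).
  by do 2 case: (_ == 0).
by exists m, q => s Ds; rewrite -fq // val_sl2 // det1.
Qed.

Let M_unit g : M g \in unitmx.
Proof. by case: (@mulmx1_unit _ _ (M g) (M (g^-1)%g)) => //; rewrite -MM mulVg. Qed.

Let scalar_fun D c : fraction_fun D (fun _ : F => c).
Proof.
by rewrite (_ : (fun _ => c) = horner c%:P); [exact: fraction_fun_poly |
  apply/funext => s; rewrite hornerC].
Qed.

Let id_fun D : fraction_fun D (fun s : F => s).
Proof.
by rewrite (_ : (fun s => s) = horner 'X); [exact: fraction_fun_poly |
  apply/funext => s; rewrite hornerX].
Qed.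

(* The coefficient of highest degree of [s |-> M (up s)] is fixed by all [up r]. *)
Lemma exists_up_fixed : exists2 v : 'rV_N, v != 0 & forall r, v *m M (up r) = v.
Proof.
have upD i j : fraction_fun 1 (fun s : F => val (up s) i j).
  apply: (fraction_fun_sl2 (a := fun=> 1) (b := id) (c := fun=> 0) (d := fun=> 1)) => // s _.
  exact: up_det.
have [m [n [B BE]]] := fraction_fun_mx (fraction_fun_rep upD).
have {BE} BE s : M (up s) = \sum_(i < n) s ^+ i *: B i.
  by rewrite -BE hornerC ?oner_eq0 // expr1n scale1r.
have up0 : up (0 : F) = 1%g.
  apply: val_inj; rewrite val_sl2 ?up_det //; apply/matrixP => i j; rewrite !mxE.
  by case: i => [[|[|i]] Hi] //; case: j => [[|[|j]] Hj].
have B_ex : exists i, (i < n)%N && (B i != 0).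
  apply: contrapT => nB; have /eqP := M1; rewrite -up0 BE big1; last first.
    move=> i _; have [->|Bi] := eqVneq (B i) 0; first by rewrite scaler0.
    by case: nB; exists i; rewrite ltn_ord.
  by move: N_gt0; case: (N) => // k _; rewrite eq_sym oner_eq0.
have B_bd i : (i < n)%N && (B i != 0) -> (i <= n)%N by case/andP => /ltnW.
have [i0 /andP[i0n Bi0] i0_max] := ex_maxnP B_ex B_bd.
(* Comparison of the coefficients of [s ^+ i0] in [M (up (s + r))]: only [j = i0] remains in the
   binomial sum, as [B j] is 0 for larger [j]. *)
have Bfix r : B i0 *m M (up r) = B i0.
  have e : forall s, (1 : {poly F}).[s] != 0 ->
    \sum_(i < n) s ^+ i *: (B i *m M (up r)) =
    \sum_(i < n) s ^+ i *: \sum_(j < n) (r ^+ (j - i) *+ 'C(j, i)) *: B j.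
    move=> s _; rewrite -sum_shift -BE; under eq_bigr do rewrite scalemxAl.
    by rewrite -mulmx_suml -BE -MM upM addrC.
  have -> := mx_poly_inj (a := fun i => B i *m M (up r))
    (b := fun i => \sum_(j < n) (r ^+ (j - i) *+ 'C(j, i)) *: B j) (oner_neq0 _) e i0n.
  rewrite (bigD1 (Ordinal i0n)) //= subnn binn.
  rewrite scale1r big1 ?addr0 // => j ji.
  have [lt|gt|eq] := ltngtP i0 j.
  - have [->|Bj] := eqVneq (B j) 0; first by rewrite scaler0.
    by have := i0_max j; rewrite ltn_ord Bj leqNgt lt => /(_ isT).
  - by rewrite bin_small // mulr0n scale0r.
  - by case/eqP: ji; apply: val_inj; rewrite /= eq.
have [i Bi] : exists i, row i (B i0) != 0.
  apply: contrapT => nB; case/eqP: Bi0; apply/row_matrixP => i; rewrite row0.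
  by apply/eqP/negPn/negP => h; apply: nB; exists i.
by exists (row i (B i0)) => // r; rewrite -row_mul Bfix.
Qed.

(** The coefficients of the Laurent polynomial [v *m M (tor t)] are weight vectors, still fixed by
    [up] since the torus normalizes this subgroup. The exponent [m] clears negative powers: the
    weight is [k - m]. *)
Lemma exists_highest_weight : exists (v : 'rV_N) m k, [/\ v != 0,
  forall r, v *m M (up r) = v &
  forall t, t != 0 -> t ^+ m *: (v *m M (tor t)) = t ^+ k *: v].
Proof.
have [v vN0 v_up] := exists_up_fixed.
have torD i j : fraction_fun 'X (fun s : F => val (tor s) i j).
  apply: (fraction_fun_sl2 (a := id) (b := fun=> 0) (c := fun=> 0) (d := GRing.inv)) => // [s|].
    by rewrite hornerX; exact: tor_det.
  by exists 1%N, 1 => s; rewrite hornerX => s0; rewrite expr1 divff // hornerC.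
have [m [n [x xE]]] := fraction_fun_mx (fraction_fun_row v torD).
have {}xE t : t != 0 -> t ^+ m *: (v *m M (tor t)) = \sum_(i < n) t ^+ i *: x i.
  by move=> t0; rewrite -xE hornerX.
have tor1 : tor (1 : F) = 1%g.
  apply: val_inj; rewrite val_sl2 ?tor_det ?oner_eq0 //; apply/matrixP => i j; rewrite !mxE.
  by case: i => [[|[|i]] Hi] //; case: j => [[|[|j]] Hj] //=; rewrite invr1.
have [k kn xk] : exists2 k, (k < n)%N & x k != 0.
  apply: contrapT => nx; case/eqP: vN0; have := xE 1 (oner_neq0 _).
  rewrite tor1 M1 mulmx1 expr1n scale1r => ->; rewrite big1 // => i _.
  have [->|xi] := eqVneq (x i) 0; first by rewrite scaler0.
  by case: nx; exists i.
have X0 : 'X != 0 :> {poly F} by rewrite polyX_eq0.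
exists (x k), m, k; split=> // [r|u u0].
  apply: (mx_poly_inj (a := fun i => x i *m M (up r)) X0 _ kn) => t.
  rewrite hornerX => t0; rewrite -xE //.
  under eq_bigr do rewrite scalemxAl.
  rewrite -mulmx_suml -xE // -scalemxAl -mulmxA -MM up_tor // MM mulmxA v_up //.
have e : forall t, 'X.[t] != 0 ->
    \sum_(i < n) t ^+ i *: (u ^+ m *: (x i *m M (tor u))) =
    \sum_(i < n) t ^+ i *: (u ^+ i *: x i).
  move=> t; rewrite hornerX => t0.
  under [RHS]eq_bigr do rewrite scalerA -exprMn [t * u]mulrC.
  under [LHS]eq_bigr do rewrite scalerA mulrC -scalerA scalemxAl.
  rewrite -scaler_sumr -mulmx_suml -!xE ?mulf_neq0 //.
  by rewrite -torM // MM exprMn -scalerA -scalemxAl mulmxA.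
exact: (mx_poly_inj (a := fun i => u ^+ m *: (x i *m M (tor u)))
  (b := fun i => u ^+ i *: x i) X0 e kn).
Qed.

Definition curve n (v : nat -> 'rV[F]_N) s := \sum_(i < n) s ^+ i *: v i.

(** The group acts on the parameter by the Moebius map [s |-> y / x], with automorphy factor [x] to
    the power [k - m], split into two natural exponents. *)
Definition equivariant_curve n v m k := forall (g : SL 2 F) s,
  let x := val g 0 0 + val g 0 1 * s in let y := val g 1 0 + val g 1 1 * s in
  x != 0 -> x ^+ m *: (curve n v s *m M g) = x ^+ k *: curve n v (y / x).

(** The curve is the orbit of a highest weight vector [w] under [um]. By [mul_um], acting by [g] on
    [w *m M (um s)] amounts to acting on [w] by an [up], which fixes it, then by [tor x], which
    scales it, then by [um (y / x)]. *)
Lemma exists_equivariant_curve : exists n v m k,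
  [/\ (0 < n)%N, v n.-1 != 0, forall i, (n <= i)%N -> v i = 0 & equivariant_curve n v m k].
Proof.
have [w [m [k [wN0 w_up w_tor]]]] := exists_highest_weight.
have umD i j : fraction_fun 1 (fun s : F => val (um s) i j).
  apply: (fraction_fun_sl2 (a := fun=> 1) (b := fun=> 0) (c := id) (d := fun=> 1)) => // s _.
  exact: um_det.
have [m0 [n [v vE]]] := fraction_fun_mx (fraction_fun_row w umD).
have {m0} vE s : w *m M (um s) = curve n v s.
  by rewrite /curve -vE hornerC ?oner_eq0 // expr1n scale1r.
have w_curve0 : w = w *m M (um 0).
  rewrite (_ : um 0 = 1%g) ?M1 ?mulmx1 //.
  apply: val_inj; rewrite val_sl2 ?um_det //; apply/matrixP => i j; rewrite !mxE.
  by case: i => [[|[|i]] Hi] //; case: j => [[|[|j]] Hj].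
have v_ex : exists i, (i < n)%N && (v i != 0).
  apply: contrapT => nv; case/eqP: wN0; rewrite w_curve0 vE /curve big1 // => i _.
  have [->|vi] := eqVneq (v i) 0; first by rewrite scaler0.
  by case: nv; exists i; rewrite ltn_ord.
have v_bd i : (i < n)%N && (v i != 0) -> (i <= n)%N by case/andP => /ltnW.
have [i0 /andP[i0n vi0] i0_max] := ex_maxnP v_ex v_bd.
(* Truncation after the last nonzero coefficient makes the degree of the curve exact. *)
pose v' i := if (i <= i0)%N then v i else 0.
have v'E s : curve i0.+1 v' s = curve n v s.
  rewrite /curve -(big_mkord xpredT (fun i => s ^+ i *: v' i)).
  rewrite -(big_mkord xpredT (fun i => s ^+ i *: v i)).
  rewrite [RHS](@big_cat_nat _ _ _ i0.+1) //= [X in _ = _ + X]big_nat_cond.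
  rewrite [X in _ = _ + X]big1 ?addr0 => [|i /andP[/andP[ii0 i_n] _]].
    by apply: eq_big_nat => i /andP[_ ii0]; rewrite /v' -ltnS ii0.
  have [->|vi] := eqVneq (v i) 0; first by rewrite scaler0.
  by have := i0_max i; rewrite i_n vi leqNgt ii0 => /(_ isT).
exists i0.+1, v', m, k; split => //; first by rewrite /v' leqnn.
  by move=> i ii0; rewrite /v' leqNgt ii0.
move=> g s x y x0; rewrite !v'E -!vE -mulmxA -MM mul_um // !MM !mulmxA w_up.
by rewrite scalemxAl w_tor // -scalemxAl.
Qed.

(** * The coefficients of the curve form a basis *)

Section EquivariantCurve.
Variables (n : nat) (v : nat -> 'rV[F]_N) (m k : nat).
Hypothesis n_gt0 : (0 < n)%N.
Hypothesis v_last : v n.-1 != 0.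
Hypothesis v_eq0 : forall i, (n <= i)%N -> v i = 0.
Hypothesis v_equi : equivariant_curve n v m k.

Let P := \matrix_(i < n) v i.

Lemma curve_um s r : curve n v s *m M (um r) = curve n v (s + r).
Proof.
have := @v_equi (um r) s; rewrite /= sl2_00 ?sl2_01 ?sl2_10 ?sl2_11 ?um_det //.
by rewrite mul0r addr0 mul1r !expr1n !scale1r divr1 oner_neq0 addrC => ->.
Qed.

Lemma curve_coef_um i r : (i < n)%N ->
  v i *m M (um r) = \sum_(j < n) (r ^+ (j - i) *+ 'C(j, i)) *: v j.
Proof.
move=> i_n; pose b i := \sum_(j < n) (r ^+ (j - i) *+ 'C(j, i)) *: v j.
apply: (mx_poly_inj (D := 1) (a := fun i => v i *m M (um r)) (b := b) (n := n)) => //.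
  exact: oner_neq0.
move=> s _; rewrite -sum_shift -/(curve n v _) -curve_um /curve mulmx_suml.
by apply: eq_bigr => j _; rewrite scalemxAl.
Qed.

(** Regrouping by powers of [r], with [e = j - i]. As [v] vanishes from [n] on, [e] can have the
    same range for every [i]. *)
Lemma curve_coef_um_shift i r : (i < n)%N ->
  v i *m M (um r) = \sum_(e < n) r ^+ e *: ('C(i + e, i)%:R *: v (i + e)%N).
Proof.
move=> i_n; rewrite curve_coef_um //.
pose f j := (r ^+ (j - i) *+ 'C(j, i)) *: v j.
transitivity (\sum_(0 <= j < i + n) f j).
  rewrite [RHS](@big_cat_nat _ _ _ n) ?leq_addl //= [X in _ = _ + X]big_nat_cond.
  rewrite [X in _ = _ + X]big1 ?addr0 => [|j /andP[/andP[nj _] _]].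
    by rewrite big_mkord.
  by rewrite /f v_eq0 // scaler0.
rewrite (@big_cat_nat _ _ _ i) ?leq_addr //= [X in X + _]big_nat_cond.
rewrite [X in X + _]big1 ?add0r => [|j /andP[/andP[_ ji] _]]; last first.
  by rewrite /f bin_small // mulr0n scale0r.
rewrite -[X in \big[_/_]_(X <= _ < _) _]add0n big_addn addKn big_mkord.
by apply: eq_bigr => e _; rewrite /f addnK addnC scalerA -mulr_natr.
Qed.

(** A relation translated by all [um s] gives one relation for each power of [s]. If [i] is the
    first index with a nonzero coefficient, the power [n.-1 - i] leaves only a nonzero multiple of
    [v n.-1]. *)
Lemma curve_coef_free : row_free P.
Proof.
rewrite -kermx_eq0; apply/rowV0P => c /sub_kermxP cP.
have cv e : (e < n)%N -> \sum_(i < n) c 0 i *: ('C(i + e, i)%:R *: v (i + e)%N) = 0.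
  apply: (mx_poly_eq0 (r := 1)
    (a := fun e => \sum_(i < n) c 0 i *: ('C(i + e, i)%:R *: v (i + e)%N))).
    exact: oner_neq0.
  move=> s _; transitivity (c *m P *m M (um s)); last by rewrite cP mul0mx.
  rewrite [c *m P]mulmx_sum_row mulmx_suml.
  under [LHS]eq_bigr do rewrite scaler_sumr.
  rewrite exchange_big /=; apply: eq_bigr => i _.
  rewrite rowK -scalemxAl curve_coef_um_shift // scaler_sumr.
  by apply: eq_bigr => l _; rewrite !scalerA [s ^+ l * _]mulrC.
suff c0 j (i : 'I_n) : (i < j)%N -> c 0 i = 0 by apply/rowP => i; rewrite (c0 n) ?mxE.
elim: j i => // j IHj i; rewrite ltnS leq_eqVlt => /orP[/eqP ij|]; last exact: IHj.
have i_n : (n.-1 - i < n)%N by have := ltn_ord i; lia.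
have := cv _ i_n; rewrite (bigD1 i) //= big1 ?addr0 => [|l li]; last first.
  have [lt|gt|eq] := ltngtP (nat_of_ord l) (nat_of_ord i).
  - by rewrite IHj ?scale0r // -ij.
  - by rewrite v_eq0 ?scaler0 //; have := ltn_ord i; lia.
  - by case/eqP: li; apply: val_inj.
rewrite subnKC; last by have := ltn_ord i; lia.
move/eqP; rewrite scalerA scaler_eq0 (negPf v_last) orbF mulf_eq0 pnatr_eq0.
rewrite -leqn0 leqNgt bin_gt0 orbC.
by rewrite (_ : i <= n.-1)%N => [/= /eqP|]; last by have := ltn_ord i; lia.
Qed.

(** By irreducibility, stability of the row space of [P] suffices. By equivariance [g] sends the
    points of the curve with [x != 0] into it, and a polynomial family with values there off the
    roots of [x] has its coefficients there. *)
Lemma curve_coef_full : row_full P.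
Proof.
have curveP s : (curve n v s <= P)%MS.
  apply: summx_sub => i _; apply: scalemx_sub.
  by rewrite -(rowK (fun i => v i) i) row_sub.
have vP i : (i < n)%N -> (v i <= P)%MS.
  by move=> i_n; rewrite -(rowK (fun i : 'I_n => v i) (Ordinal i_n)) row_sub.
pose W : 'M_N := <<P>>%MS.
suff /M_irr [W0|] : forall g, (W *m M g <= W)%MS.
- have := vP n.-1; rewrite prednK // leqnn => /(_ isT).
  by rewrite -(genmxE P) -/W W0 submx0 (negPf v_last).
- by rewrite -!sub1mx genmxE.
move=> g; rewrite /W (eqmxMr _ (genmxE P)) genmxE.
apply/row_subP => i; rewrite row_mul rowK submxE; apply/eqP.
pose x := (val g 0 0)%:P + (val g 0 1)%:P * 'X.
have xE s : x.[s] = val g 0 0 + val g 0 1 * s by rewrite !hornerE.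
have x0 : x != 0.
  apply/eqP => x0.
  have a0 : val g 0 0 = 0 by have := xE 0; rewrite x0 horner0 mulr0 addr0.
  have b0 : val g 0 1 = 0 by have := xE 1; rewrite x0 horner0 mulr1 a0 add0r.
  by have /eqP := det_SL2 g; rewrite a0 b0 !mul0r subr0 eq_sym oner_eq0.
apply: (mx_poly_eq0 (n := n) (a := fun i => v i *m M g *m cokermx P) x0) => //.
move=> s; rewrite xE => xs.
under eq_bigr do rewrite !scalemxAl.
rewrite -!mulmx_suml -/(curve n v s).
apply/eqP; rewrite -submxE.
have := v_equi xs; set x' := val g 0 0 + _ => e.
have x'0 : x' ^+ m != 0 by rewrite expf_neq0.
by rewrite -(eqmx_scale _ x'0) e scalemx_sub.
Qed.

Lemma curve_length : n = N.
Proof.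
by have := curve_coef_free; have := curve_coef_full; rewrite /row_free /row_full => /eqP -> /eqP.
Qed.

End EquivariantCurve.

(** * Matrices of the generators in the basis of coefficients *)

Section FullEquivariantCurve.
Variables (v : nat -> 'rV[F]_N) (m k : nat).
Hypothesis v_last : v N.-1 != 0.
Hypothesis v_eq0 : forall i, (N <= i)%N -> v i = 0.
Hypothesis v_equi : equivariant_curve N v m k.

Let P := \matrix_(i < N) v i.

Lemma full_curve_um r : P *m M (um r) = shiftmx N r *m P.
Proof.
apply/row_matrixP => i; rewrite !row_mul rowK (curve_coef_um v_equi) //.
rewrite mulmx_sum_row; apply: eq_bigr => j _.
by rewrite rowK !mxE.
Qed.

(** [tor t^-1] acts on the parameter by [s |-> t ^+ 2 * s], so it scales the coefficient of [s ^+ j]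
    by [t ^+ j.*2], up to the automorphy factor [c]. *)
Lemma full_curve_tor t : t != 0 -> exists2 c, c != 0 &
  P *m M (tor t^-1) = diag_mx (\row_j (c * t ^+ j.*2)) *m P.
Proof.
move=> t0; have t'0 : t^-1 != 0 by rewrite invr_eq0.
exists (t^-1 ^+ k / t^-1 ^+ m); first by rewrite mulf_neq0 ?invr_eq0 ?expf_neq0.
apply/row_matrixP => i; rewrite !row_mul row_diag_mx -scalemxAl -rowE !rowK mxE.
set c := _ / _.
apply: (mx_poly_inj (D := 1) (a := fun i => v i *m M (tor t^-1))
  (b := fun i => (c * t ^+ i.*2) *: v i) (n := N)) => //; first exact: oner_neq0.
move=> s _; under eq_bigr do rewrite scalemxAl.
rewrite -mulmx_suml -/(curve N v s).
have := @v_equi (tor t^-1) s; rewrite /= sl2_00 ?sl2_01 ?sl2_10 ?sl2_11 ?tor_det //.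
rewrite mul0r addr0 add0r => /(_ t'0) e.
have tm0 : t^-1 ^+ m != 0 by rewrite expf_neq0.
apply: (scalerI tm0); rewrite e /curve !scaler_sumr; apply: eq_bigr => i' _.
rewrite !scalerA; congr (_ *: _); rewrite !invrK /c -mul2n exprM !exprMn.
by field; rewrite expf_neq0.
Qed.

(** This element acts on the parameter by [s |-> - s^-1]. Multiplication by [s ^+ N.-1] makes the
    transformed curve a polynomial again, with coefficients reversed up to sign. *)
Lemma full_curve_weyl : exists e : 'I_N -> F, (forall i, e i != 0) /\
  P *m M (sl2 0 1 (-1) 0) = \matrix_(i, j) (e i *+ (j == rev_ord i)) *m P.
Proof.
set w := sl2 0 1 (-1) 0.
have wdet : 0 * 0 - 1 * (-1) = 1 :> F by rewrite mul0r mul1r opprK add0r.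
have P_unit : P \in unitmx.
  by rewrite -row_free_unit; exact: (curve_coef_free N_gt0 v_last v_eq0 v_equi).
have v_neq0 i : (i < N)%N -> v i != 0.
  move=> i_N; apply/eqP => vi0.
  have /(congr1 (mulmx^~ (invmx P))) : delta_mx 0 (Ordinal i_N) *m P = 0 :> 'rV_N.
    by rewrite -rowE rowK.
  rewrite mulmxK // mul0mx => /rowP/(_ (Ordinal i_N)).
  by rewrite !mxE !eqxx /= => /eqP; rewrite oner_eq0.
pose a i := v i *m M w.
pose b i := (-1) ^+ (N.-1 - i) *: v (N.-1 - i)%N.
have a0 : a 0%N != 0.
  apply/eqP => /(congr1 (mulmx^~ (invmx (M w)))); rewrite mulmxK // mul0mx.
  by apply/eqP/v_neq0.
have b0 : b 0%N != 0.
  by rewrite /b subn0 scaler_eq0 expf_eq0 oppr_eq0 oner_eq0 andbF v_neq0 ?prednK.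
have ab s : s != 0 -> s ^+ (m + N.-1) *: \sum_(i < N) s ^+ i *: a i =
    s ^+ k *: \sum_(i < N) s ^+ i *: b i.
  move=> s0; have := @v_equi w s; rewrite /= sl2_00 ?sl2_01 ?sl2_10 ?sl2_11 //.
  rewrite add0r mul1r mul0r addr0 => /(_ s0) e.
  rewrite addnC exprD -scalerA; under eq_bigr do rewrite scalemxAl.
  rewrite -mulmx_suml e scalerA mulrC -scalerA; congr (_ *: _).
  rewrite /curve scaler_sumr (reindex_inj rev_ord_inj); apply: eq_bigr => i _ /=.
  rewrite /b (_ : N - i.+1 = N.-1 - i)%N; last by rewrite -subn1 -subnDA.
  rewrite !scalerA; congr (_ *: _); rewrite mulN1r [(- _^-1) ^+ _]exprNn exprVn.
  have -> : s ^+ N.-1 = s ^+ i * s ^+ (N.-1 - i).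
    by rewrite -exprD subnKC //; have := ltn_ord i; lia.
  by field; rewrite expf_neq0.
(* Both constant terms are nonzero, so the powers of [s] in front must agree. *)
have mk : (m + N.-1)%N = k.
  have [lt|gt|//] := ltngtP (m + N.-1)%N k.
  - case/eqP: a0; apply: (mx_poly_trail_eq0 (n := N) (e := k - (m + N.-1)) (b := b)) => //.
      by rewrite subn_gt0.
    move=> s s0; apply: (@scalerI _ _ (s ^+ (m + N.-1))); first by rewrite expf_neq0.
    by rewrite ab // scalerA -exprD subnKC // ltnW.
  - case/eqP: b0; apply: (mx_poly_trail_eq0 (n := N) (e := m + N.-1 - k) (b := a)) => //.
      by rewrite subn_gt0.
    move=> s s0; apply: (@scalerI _ _ (s ^+ k)); first by rewrite expf_neq0.
    by rewrite -ab // scalerA -exprD subnKC // ltnW.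
exists (fun i => (-1) ^+ (N.-1 - i)); split=> [i|].
  by rewrite expf_eq0 oppr_eq0 oner_eq0 andbF.
apply/row_matrixP => i; rewrite !row_mul rowK [RHS]mulmx_sum_row (bigD1 (rev_ord i)) //=.
rewrite big1 ?addr0 => [|j /negPf ji]; last by rewrite !mxE ji mulr0n scale0r.
rewrite !mxE eqxx mulr1n rowK /= -/(a i).
rewrite (_ : N - i.+1 = N.-1 - i)%N; last by rewrite -subn1 -subnDA.
apply: (mx_poly_inj (D := 'X) (a := a) (b := b) (n := N)) => //.
  by rewrite polyX_eq0.
move=> s; rewrite hornerX => s0; apply: (@scalerI _ _ (s ^+ k)); first by rewrite expf_neq0.
by rewrite -ab // mk.
Qed.

End FullEquivariantCurve.

(** Conjugation by [P] brings the generators to the form required by [mx_translates_span_rank]. *)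
Lemma rep_translates_span d (U : 'M[F]_N) :
  (N <= d * \rank U)%N -> mx_translates_span M d U.
Proof.
have [n [v [m [k [n_gt0 v_last v_eq0 v_equi]]]]] := exists_equivariant_curve.
have nN := curve_length n_gt0 v_last v_eq0 v_equi; subst n => N_dU.
pose P := \matrix_(i < N) v i.
have P_unit : P \in unitmx.
  by rewrite -row_free_unit; exact: (curve_coef_free n_gt0 v_last v_eq0 v_equi).
pose M' g := P *m M g *m invmx P.
have M'E g A : P *m M g = A *m P -> M' g = A by rewrite /M' => ->; rewrite mulmxK.
have [||t t0|s|||g gU] := @mx_translates_span_rank F N _ M' _ _ _ _ _ d (U *m invmx P).
- by rewrite /M' M1 mulmx1 mulmxV.
- by move=> g h; rewrite /M' MM !mulmxA mulmxKV.
- have [c c0 e] := full_curve_tor v_equi t0.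
  by exists (tor t^-1), c; split => //; exact: M'E.
- by exists (um s); apply: M'E; exact: (full_curve_um v_equi).
- have [e [e0 we]] := full_curve_weyl v_last v_eq0 v_equi.
  by exists (sl2 0 1 (-1) 0), e; split => //; exact: M'E.
- by rewrite mxrankMfree ?row_free_unit ?unitmx_inv.
exists g; rewrite -sub1mx; move: gU; rewrite -sub1mx => /sub_sumsmxP[C e].
apply/sub_sumsmxP; exists (fun i => invmx P *m C i).
have := congr1 (fun A => invmx P *m A *m P) e.
rewrite mulmx1 mulVmx // => ->; rewrite mulmx_sumr mulmx_suml.
by apply: eq_bigr => i _; rewrite /M' !mulmxA !mulmxKV.
Qed.

End MatrixRepresentation.

(** * Additive diameters *)

Section VectorRepresentation.
Variables (F : numFieldType) (V : vectType F).
Variable rho : representation (SL 2 F) V.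

Definition rep_mx (g : SL 2 F) : 'M[F]_(dim V) := f2mx (rho g).

Lemma v2r_lfun (f : 'End(V)) u : v2r (f u) = v2r u *m f2mx f.
Proof. by rewrite unlock /= r2vK. Qed.

Lemma rep_mx1 : rep_mx 1%g = 1%:M.
Proof.
apply/row_matrixP => i; rewrite row1 rowE.
by rewrite -[delta_mx _ _](@r2vK _ V) -v2r_lfun rep1 id_lfunE.
Qed.

Lemma rep_mxM g h : rep_mx (g * h)%g = rep_mx h *m rep_mx g.
Proof.
apply/row_matrixP => i; rewrite !rowE mulmxA.
by rewrite -[delta_mx _ _](@r2vK _ V) -!v2r_lfun repM comp_lfunE.
Qed.

Lemma rep_mx_poly : rep_algebraic rho -> forall i j,
  exists p : {mpoly F[2 * 2]}, forall g, rep_mx g i j = p.@[fun k => mxvec (val g) 0 k].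
Proof.
move=> rho_alg i j; pose f (u : V) : F^o := v2r u 0 j.
have f_lin : linear f by move=> a u w; rewrite /f linearP !mxE.
pose f' : {linear V -> F^o} := HB.pack f (GRing.isLinear.Build _ _ _ _ f f_lin).
have [p pE] := rho_alg (linfun f') (r2v (delta_mx 0 i)); exists p => g.
by rewrite -pE lfunE /= /f v2r_lfun r2vK -rowE mxE.
Qed.

Lemma mem_vs2mx (U : {vspace V}) u : (u \in U) = (v2r u <= vs2mx U)%MS.
Proof. by rewrite -genmxE. Qed.

Lemma rep_mx_irr : rep_irreducible rho -> forall W : 'M_(dim V),
  (forall g, (W *m rep_mx g <= W)%MS) -> W = 0 \/ row_full W.
Proof.
move=> [_ irr] W Wst.
have memW u : (u \in mx2vs W) = (v2r u <= W)%MS by rewrite mem_vs2mx mx2vsK.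
have [g|W0|WT] := irr (mx2vs W).
- apply/subvP => w /memv_imgP[u]; rewrite memW => uW ->; rewrite memW v2r_lfun.
  exact: submx_trans (submxMr _ uW) (Wst g).
- left; apply/row_matrixP => i; rewrite row0.
  have : r2v (row i W) \in mx2vs W by rewrite memW r2vK row_sub.
  by rewrite W0 memv0 => /eqP/(congr1 v2r); rewrite r2vK linear0.
right; rewrite -sub1mx; apply/row_subP => i.
by rewrite -[row i _](@r2vK _ V) -memW WT memvf.
Qed.

(** One direction is subadditivity of the dimension; the other is [rep_translates_span] in
    coordinates. *)
Lemma translates_span_dim d (U : {vspace V}) :
  rep_algebraic rho -> rep_irreducible rho ->
  translates_span rho U d <-> (\dim {:V} <= d * \dim U)%N.
Proof.
move=> rho_alg rho_irr; split=> [[g gU]|].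
  rewrite -gU; apply: leq_trans (dimv_leq_sum _ _ _) _.
  rewrite -[X in (_ <= X * _)%N]card_ord -sum_nat_const; apply: leq_sum => i _.
  by rewrite -(limg_ker_dim (rho (g i)) U) leq_addl.
rewrite dimvf => le_dU.
have V_gt0 : (0 < dim V)%N.
  by rewrite -dimvf lt0n dimv_eq0; apply/eqP; case: rho_irr.
have [g gU] := rep_translates_span V_gt0 rep_mx1 rep_mxM (rep_mx_poly rho_alg)
  (rep_mx_irr rho_irr) le_dU.
exists g; apply/eqP; rewrite eqEsubv subvf; apply/subvP => u _.
have /sub_sumsmxP[C uE] : (v2r u <= \sum_i vs2mx U *m rep_mx (g i))%MS.
  by apply: submx_trans (submx1 _) _; rewrite sub1mx.
rewrite -(v2rK u) uE linear_sum; apply: memv_sumr => i _.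
rewrite mulmxA -(@r2vK _ V (C i *m _)) -v2r_lfun /= v2rK memv_img //.
by rewrite mem_vs2mx r2vK submxMl.
Qed.

End VectorRepresentation.

(** The ceiling is nonnegative here, so its absolute value is the ceiling itself. *)
Lemma absz_ceil_div_le (m k d : nat) : (0 < k)%N ->
  (`|Num.ceil (m%:R / k%:R : rat)| <= d)%N = (m <= d * k)%N.
Proof.
move=> k0; have k0' : 0 < k%:R :> rat by rewrite ltr0n.
have c0 : 0 <= Num.ceil (m%:R / k%:R : rat).
  by rewrite ceil_ge0 (lt_le_trans _ (divr_ge0 (ler0n _ _) (ler0n _ _))) // ltrN10.
rewrite -lez_nat gez0_abs // ceil_le_int // ler_pdivrMr // -pmulrn -natrM.
exact: ler_nat.
Qed.

Theorem theorem1p4 (R : realType) (V : vectType R[i])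
    (rho : representation (SL 2 R[i]) V) :
  rep_algebraic rho -> rep_irreducible rho ->
  forall U : {vspace V}, U <> 0%VS ->
    add_diam rho U =
      Some `|Num.ceil ((\dim {:V})%:R / (\dim U)%:R : rat)|%N.
Proof.
move=> rho_alg rho_irr U /eqP U0.
have U_gt0 : (0 < \dim U)%N by rewrite lt0n dimv_eq0.
have spanP d := translates_span_dim d U rho_alg rho_irr.
rewrite /add_diam; case: pselect => [ex_d|[]]; last first.
  (* Since [\dim U] is positive, [\dim {:V}] translates suffice: the infinite value does not
     occur. *)
  exists (\dim {:V}); apply/asboolP/spanP; exact: leq_pmulr.
congr Some; case: ex_minnP => d /asboolP/spanP d_span d_min.
apply/eqP; rewrite eqn_leq absz_ceil_div_le // d_span andbT.
by apply: d_min; apply/asboolP/spanP; rewrite -absz_ceil_div_le.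
Qed.
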